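(* \textsc{Broadcast Domination} parameterized by the solution cost $k$ can be solved in time $2^{O(k\log k)}n^{O(1)}$ on DAGs of order $n$.
   Context: Digraphs are finite and assumed weakly connected. For vertices $u,v$ of a digraph $D$, $d(u,v)$ is the length of a shortest directed path from $u$ to $v$ ($\infty$ if none). A dominating broadcast of $D$ is a function $f:V(D)\to\mathbb{N}$ such that for every vertex $v$ there is a vertex $t$ with $f(t)>0$ and $d(t,v)\le f(t)$; its cost is $\sum_v f(v)$. \textsc{Broadcast Domination}: given a digraph $D$ and an integer $k$, decide whether $D$ has a dominating broadcast of cost at most $k$. A DAG is a digraph with no directed cycle; the order is the number of vertices. *)

(* Defs.v *)
From mathcomp Require Import all_boot.

Set Implicit Arguments.
Unset Strict Implicit.
Unset Printing Implicit Defensive.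

(** * Digraphs, given by their arc relation *)

Section Digraph.
Variables (T : finType) (D : rel T).

Definition weakly_connected : Prop :=
  forall u v, connect [rel x y | D x y || D y x] u v.

(* [ucycle] is a closed walk without repeated vertices; the loop [:: x] with
   [D x x] is one. *)
Definition acyclic : Prop := forall c : seq T, ucycle D c -> c = [::].

Definition dipath (u v : T) (l : nat) : bool :=
  [exists p : l.-tuple T, [&& path D u p, uniq (u :: p) & last u p == v]].

Lemma dipath_ex u v : connect D u v -> exists l, dipath u v l.
Proof.
case/connectP=> p Dp ->; case/shortenP: Dp => q Dq Uq _.
exists (size q); apply/existsP; exists (in_tuple q).
by apply/and3P; split.
Qed.

(* [None] is the infinite distance. *)
Definition dist (u v : T) : option nat :=
  if @idP (connect D u v) is ReflectT uv then Some (ex_minn (dipath_ex uv))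
  else None.

Definition dist_le (d : option nat) (r : nat) : bool :=
  if d is Some l then l <= r else false.

Definition dominating_broadcast (f : T -> nat) : Prop :=
  forall v, exists t, 0 < f t /\ dist_le (dist t v) (f t).

Definition broadcast_cost (f : T -> nat) : nat := \sum_v f v.

Definition broadcast_domination (k : nat) : Prop :=
  exists f : T -> nat, dominating_broadcast f /\ broadcast_cost f <= k.

End Digraph.

(** * Random access machines

    A unit-cost RAM with a read-only input and an unbounded work memory of
    natural numbers, both with indirect addressing, and with structured control
    flow.  The only arithmetic is addition and truncated subtraction: a step
    makes words grow by at most one bit (up to program constants), so time is
    polynomially related to Turing machine time.  In particular there is no
    unit-cost multiplication. *)

Definition memory := nat -> nat.

Inductive expr : Type :=
  | Const of nat
  | Input of expr
  | Mem of expr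
  | Add of expr & expr
  | Sub of expr & expr.

Inductive cmd : Type :=
  | Skip
  | Store of expr & expr
  | Seq of cmd & cmd
  | If of expr & cmd & cmd
  | While of expr & cmd.

(* Cells beyond the end of the input read as 0. *)
Fixpoint eval (x : seq nat) (m : memory) (a : expr) : nat :=
  match a with
  | Const n => n
  | Input b => nth 0 x (eval x m b)
  | Mem b => m (eval x m b)
  | Add b c => eval x m b + eval x m c
  | Sub b c => eval x m b - eval x m c
  end.

Fixpoint eval_time (a : expr) : nat :=
  match a with
  | Const _ => 1
  | Input b | Mem b => (eval_time b).+1
  | Add b c | Sub b c => (eval_time b + eval_time c).+1
  end.

Definition update (m : memory) (i w : nat) : memory :=
  fun j => if j == i then w else m j.

(* [exec x p m t m']: on input [x], started in memory [m], the program [p] halts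
   after exactly [t] steps in memory [m'].  Nonzero guards are true. *)
Inductive exec (x : seq nat) : cmd -> memory -> nat -> memory -> Prop :=
  | exec_skip m : exec x Skip m 1 m
  | exec_store a b m :
      exec x (Store a b) m (eval_time a + eval_time b).+1
           (update m (eval x m a) (eval x m b))
  | exec_seq p q m t m1 t1 m2 :
      exec x p m t m1 -> exec x q m1 t1 m2 ->
      exec x (Seq p q) m (t + t1) m2
  | exec_if_true a p q m t m1 :
      0 < eval x m a -> exec x p m t m1 ->
      exec x (If a p q) m (eval_time a + t).+1 m1
  | exec_if_false a p q m t m1 :
      eval x m a = 0 -> exec x q m t m1 ->
      exec x (If a p q) m (eval_time a + t).+1 m1
  | exec_while_true a p m t m1 t1 m2 :
      0 < eval x m a -> exec x p m t m1 -> exec x (While a p) m1 t1 m2 ->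
      exec x (While a p) m (eval_time a + t + t1).+1 m2
  | exec_while_false a p m :
      eval x m a = 0 -> exec x (While a p) m (eval_time a).+1 m.

Lemma exec_deterministic x p m t m1 t' m1' :
  exec x p m t m1 -> exec x p m t' m1' -> t = t' /\ m1 = m1'.
Proof.
move=> H; elim: H t' m1' => {p m t m1}; intros;
  match goal with E : exec _ _ _ ?t' _ |- _ = ?t' /\ _ => inversion E; subst end;
  repeat match goal with
  | G : is_true (0 < ?b), E : ?b = 0 |- _ => by rewrite E in G
  | IH : forall t' m', exec ?x ?p ?m t' m' -> _, E : exec ?x ?p ?m _ _ |- _ =>
      case: (IH _ _ E) => ? ?; subst; clear IH
  end; by [].
Qed.

(* Work memory is initially zero; the verdict is left in cell 0. *)
Definition decides_within (p : cmd) (x : seq nat) (answer : Prop) (time : nat) :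
    Prop :=
  exists t m, [/\ exec x p (fun=> 0) t m, t <= time & (0 < m 0 <-> answer)].

(* The order, the budget, then the adjacency matrix row by row. *)
Definition encode (n : nat) (D : rel 'I_n) (k : nat) : seq nat :=
  [:: n, k & [seq nat_of_bool (D i j) | i <- enum 'I_n, j <- enum 'I_n]].

Definition bigO (g h : nat -> nat) : Prop :=
  exists c k0, forall k, k0 <= k -> g k <= c * h k.

(* Main.v *)
(* If a broadcasting vertex t' is covered by another broadcasting vertex t, then
   moving the power of t' to t preserves domination and cost.  So there is an
   optimal broadcast in which no broadcasting vertex is covered by another one.
   In a DAG, build such a broadcast greedily: the first undominated vertex in
   topological order must broadcast, since any vertex covering it precedes it,
   hence is already covered by an earlier broadcasting vertex.  Only the powers
   have to be guessed, and they are encoded by a word of k bits, each spending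
   one unit of cost either on the current vertex or on the next forced one.

   The machine tries all 2^k words.  Topological order is replaced by the length
   of a longest path ending at each vertex; this and the remaining power of a
   broadcast at each vertex are both obtained by n rounds of relaxation over all
   arcs. *)

From mathcomp Require Import all_boot.
From mathcomp Require Import zify.
Require Import Defs.

Set Implicit Arguments.
Unset Strict Implicit.
Unset Printing Implicit Defensive.

(** * Irredundant broadcasts *)

Section Walks.
Variables (T : finType) (D : rel T).
Implicit Types (u v w t : T) (F f : T -> nat).

(** Repeated vertices are allowed, unlike in [dipath], so walks concatenate freely. The last arc is
    split off because relaxation pushes values forward along one more arc. *)
Fixpoint walk (l : nat) u v : bool :=
  if l is l'.+1 then [exists w, walk l' u w && D w v] else u == v.

Lemma walkP l u v :
  reflect (exists p, [/\ path D u p, last u p = v & size p = l]) (walk l u v).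
Proof.
apply: (iffP idP).
  elim: l v => [|l IH] v /=; first by move/eqP=> <-; exists [::].
  case/existsP=> w /andP[/IH [p [Dp <- <-]] Dwv].
  by exists (rcons p v); rewrite rcons_path Dp last_rcons size_rcons.
case=> p []; elim/last_ind: p l v => [|p w IH] l v.
  by move=> _ /= -> <- /=.
rewrite rcons_path last_rcons size_rcons => /andP[Dp Dw] <- <- /=.
by apply/existsP; exists (last u p); rewrite Dw andbT; apply: IH.
Qed.

Lemma walk_cat l1 l2 u v w : walk l1 u v -> walk l2 v w -> walk (l1 + l2) u w.
Proof.
case/walkP=> p [Dp pv <-] /walkP[q [Dq qw <-]]; apply/walkP; exists (p ++ q).
by rewrite cat_path last_cat size_cat pv Dp Dq.
Qed.

Lemma walk_dist_le l r u v : walk l u v -> l <= r -> dist_le (dist D u v) r.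
Proof.
case/walkP=> p [Dp pv pl] lr.
rewrite /dist; case: {-}_ / idP => [uv|]; last first.
  by case; apply/connectP; exists p.
rewrite /=; case: ex_minnP => l0 _ /(_ (size (shorten u p))) min_l0.
case/shortenP: Dp min_l0 pv => q Dq Uq sub min_l0 pv.
apply: leq_trans (min_l0 _) (leq_trans _ lr).
  by apply/existsP; exists (in_tuple q); rewrite Dq Uq pv eqxx.
by rewrite -pl; apply: uniq_leq_size sub; case/andP: Uq.
Qed.

(** A shortest path has distinct vertices. The resulting bound [l < #|T|] is why [#|T|] rounds of
    relaxation suffice. *)
Lemma dist_le_walk r u v :
  dist_le (dist D u v) r -> exists l, [/\ l <= r, l < #|T| & walk l u v].
Proof.
rewrite /dist; case: {-}_ / idP => [uv|//] /=; case: ex_minnP => l.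
case/existsP=> p /and3P[Dp Up /eqP pv] _ lr; exists l; split=> //.
  by have := max_card (mem (u :: p)); rewrite (card_uniqP Up) /= size_tuple.
by apply/walkP; exists p; rewrite Dp pv size_tuple.
Qed.

Lemma dist_le_trans r s u v w :
  dist_le (dist D u v) r -> dist_le (dist D v w) s ->
  dist_le (dist D u w) (r + s).
Proof.
case/dist_le_walk=> l [lr _ luv] /dist_le_walk[l' [ls _ lvw]].
exact: walk_dist_le (walk_cat luv lvw) (leq_add lr ls).
Qed.

Lemma dist_le_weaken d r s : dist_le d r -> r <= s -> dist_le d s.
Proof. by case: d => //= l lr; apply: leq_trans. Qed.

(** The tail is duplicate-free by induction, so a return to [u] would close a cycle without repeated
    vertices. *)
Lemma acyclic_uniq u p : acyclic D -> path D u p -> uniq (u :: p).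
Proof.
move=> acD; elim: p u => [|v p IH] u //= /andP[Duv Dp].
have Uvp := IH v Dp; rewrite -/(uniq (v :: p)) Uvp andbT.
apply/negP => u_vp; have Dvp : path D u (v :: p) by rewrite /= Duv.
case/splitPr: u_vp Dvp Uvp => p1 p2.
rewrite -cat_rcons cat_path cat_uniq rcons_uniq => /andP[Dp1 _].
case/and3P=> /andP[u_p1 Up1] _ _.
by have := acD (u :: p1); rewrite /ucycle /= Dp1 u_p1 Up1 => /(_ isT).
Qed.

Lemma walk_lt_card l u v : acyclic D -> walk l u v -> l < #|T|.
Proof.
move=> acD /walkP[p [Dp _ <-]].
by have := max_card (mem (u :: p)); rewrite (card_uniqP (acyclic_uniq acD Dp)).
Qed.

(* The outcome of at least [#|T|] rounds of in-place updates
   [X w := maxn (X w) (g (X u))] over all arcs [(u, w)]. *)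
Definition relaxed (g : nat -> nat) (X X' : T -> nat) : Prop :=
  (forall v, exists u l, walk l u v /\ X' v = iter l g (X u)) /\
  (forall u v l, l <= #|T| -> walk l u v -> iter l g (X u) <= X' v).

(** * In-place relaxation over all arcs *)

Section Relaxation.
Variables (g : nat -> nat) (X0 : T -> nat).
Hypothesis g_homo : {homo g : i j / i <= j}.
Implicit Types (X : T -> nat) (P : rel T).

(* [i] rounds are complete and the arcs in [P] are done in the current one. *)
Definition relaxing (i : nat) P X : Prop :=
  [/\ forall v, exists u l, walk l u v /\ X v = iter l g (X0 u),
      forall u v l, l <= i -> walk l u v -> iter l g (X0 u) <= X v
    & forall a u v l, P u v -> D u v -> l <= i -> walk l a u ->
        iter l.+1 g (X0 a) <= X v].

Lemma relaxing_eq i P X X' : X' =1 X -> relaxing i P X -> relaxing i P X'.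
Proof.
move=> e [s l x]; split=> [v|u v j ji uv|a u v j Puv Duv ji au]; rewrite e.
- exact: s.
- exact: l.
- exact: x au.
Qed.

Lemma relaxing_sub i P P' X : subrel P' P -> relaxing i P X -> relaxing i P' X.
Proof. by move=> PP [s l x]; split=> // a u v j /PP; apply: x. Qed.

Lemma relaxing0 : relaxing 0 (fun _ _ => false) X0.
Proof.
split=> // [v|u v l]; first by exists v, 0 => /=.
by rewrite leqn0 => /eqP-> /eqP->.
Qed.

Lemma relaxing_next i P X :
  (forall u v, P u v) -> relaxing i P X -> relaxing i.+1 (fun _ _ => false) X.
Proof.
move=> allP [s l x]; split=> // u v [|j] ji uv; first exact: l.
have [w /andP[uw wv]] := existsP uv; exact: x uw.
Qed.

Lemma relaxing_skip i P P' X u w :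
  (forall u' w', P' u' w' -> P u' w' \/ u' = u /\ w' = w) -> ~~ D u w ->
  relaxing i P X -> relaxing i P' X.
Proof.
move=> PP nD [s l x]; split=> // a u' w' j /PP[Puw|[-> ->]]; first exact: x.
by rewrite (negPf nD).
Qed.

(** By truncated subtraction, [X w + (g (X u) - X w)] is a maximum. Working in place may use values
    improved in the same round; this is harmless, since each value is still attained along some walk
    and lower bounds survive any increase. *)
Lemma relaxing_step i P P' X X' u w :
  (forall u' w', P' u' w' -> P u' w' \/ u' = u /\ w' = w) -> relaxing i P X ->
  D u w -> X' =1 (fun v => if v == w then X w + (g (X u) - X w) else X v) ->
  relaxing i P' X'.
Proof.
move=> PP [s l x] Duw eX.
have leX v : X v <= X' v by rewrite eX; case: eqP => [->|//]; exact: leq_addr.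
split=> [v|a v j ji av|a u' v j + Dv ji au].
- rewrite eX; case: eqP => [->|_]; last exact: s.
  have [le|/ltnW lt] := leqP (g (X u)) (X w).
    by rewrite (eqP le) addn0; apply: s.
  rewrite subnKC //; have [a [j [au ->]]] := s u; exists a, j.+1; split=> //=.
  by apply/existsP; exists u; rewrite au.
- exact: leq_trans (l _ _ _ ji av) _.
- case/PP=> [Pv|[eu ev]]; first exact: leq_trans (x _ _ _ _ Pv Dv ji au) _.
  rewrite ev eX eqxx eu in au *; apply: leq_trans (g_homo (l _ _ _ ji au)) _.
  by rewrite -leq_subLR.
Qed.

Lemma relaxing_relaxed i P X : #|T| <= i -> relaxing i P X -> relaxed g X0 X.
Proof.
by move=> Ti [s l _]; split=> // u v j jT; apply: l; apply: leq_trans Ti.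
Qed.

End Relaxation.

Lemma relaxed_eq g X0 X1 X : X0 =1 X1 -> relaxed g X0 X -> relaxed g X1 X.
Proof.
move=> e [s l]; split=> [v|u v j]; last by rewrite -e; apply: l.
by have [u [j [uv ->]]] := s v; exists u, j; rewrite e.
Qed.

(** * Domination and potentials read off from relaxation *)

Definition dominated F v : bool :=
  [exists t, (0 < F t) && dist_le (dist D t v) (F t)].

Definition all_dominated F : bool := [forall v, dominated F v].

Lemma all_dominatedP F : reflect (dominating_broadcast D F) (all_dominated F).
Proof.
apply: (iffP forallP) => dF v.
  by have /existsP[t /andP[Ft tv]] := dF v; exists t.
by have [t [Ft tv]] := dF v; apply/existsP; exists t; rewrite Ft.
Qed.

Lemma dominated_le F F' v :
  (forall t, F t <= F' t) -> dominated F v -> dominated F' v.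
Proof.
move=> leF /existsP[t /andP[Ft tv]]; apply/existsP; exists t.
by rewrite (leq_trans Ft) ?leF //= (dist_le_weaken tv).
Qed.

Lemma all_dominated_le F F' :
  (forall t, F t <= F' t) -> all_dominated F -> all_dominated F'.
Proof.
by move=> leF /forallP dF; apply/forallP=> v; apply: dominated_le (dF v).
Qed.

Lemma iter_predn l a : iter l predn a = a - l.
Proof. by elim: l => [|l IH]; rewrite ?subn0 //= IH subnS. Qed.

(** The initial value is [F t + 1] at a broadcasting vertex and 0 elsewhere, so what remains after a
    walk of length [l] is positive exactly when [0 < F t] and [l <= F t]. *)
Lemma relaxed_dominated F R v :
  relaxed predn (fun t => F t + (1 - (1 - F t))) R -> (0 < R v) = dominated F v.
Proof.
case=> sound low; apply/idP/idP.
  have [u [l [luv ->]]] := sound v; rewrite iter_predn => Rv.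
  apply/existsP; exists u; apply/andP; split; first by lia.
  by apply: walk_dist_le luv _; lia.
case/existsP=> t /andP[Ft /dist_le_walk[l [lF lT ltv]]].
by have := low t v l (ltnW lT) ltv; rewrite iter_predn; lia.
Qed.

(** Here [h v] is the length of a longest walk ending at [v]. Acyclicity keeps all walks shorter
    than [#|T|], so the relaxation sees every one, and an arc prolongs a longest walk. *)
Lemma relaxed_potential h :
  acyclic D -> relaxed succn (fun=> 0) h ->
  (forall u v, D u v -> h u < h v) /\ (forall v, h v <= #|T|).
Proof.
move=> acD [sound low].
have iterS l : iter l succn 0 = l by elim: l => //= l ->.
split=> [u v Duv|v].
  have [a [l [lau ->]]] := sound u; rewrite iterS.
  have lav : walk l.+1 a v by rewrite /=; apply/existsP; exists u; rewrite lau.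
  by have := low a v l.+1 (ltnW (walk_lt_card acD lav)) lav; rewrite iterS.
have [a [l [lav ->]]] := sound v; rewrite iterS.
exact: ltnW (walk_lt_card acD lav).
Qed.

Lemma potential_walk h l u v :
  (forall u v, D u v -> h u < h v) -> walk l u v -> (u == v) || (h u < h v).
Proof.
move=> hD; elim: l v => [|l IH] v /=; first by move->.
case/existsP=> w /andP[/IH/predU1P[->|huw] Dwv]; first by rewrite hD ?orbT.
by rewrite (ltn_trans huw (hD _ _ Dwv)) orbT.
Qed.

Definition irredundant f : Prop :=
  forall t t', 0 < f t -> 0 < f t' -> dist_le (dist D t t') (f t) -> t = t'.

(* A broadcasting vertex [t'] covered by [t] can hand its power over to [t]. *)
Lemma irredundant_broadcast k :
  broadcast_domination D k ->
  exists f,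
    [/\ dominating_broadcast D f, broadcast_cost f <= k & irredundant f].
Proof.
(* Induction on the number of broadcasting vertices: each transfer silences [t']. *)
case=> f [domf costf]; have [m] := ubnP #|[set t | 0 < f t]|.
elim: m => // m IH in f domf costf *; rewrite ltnS => supp_f.
pose bad t t' := [&& t != t', 0 < f t, 0 < f t' & dist_le (dist D t t') (f t)].
case: (boolP [exists t, exists t', bad t t']) => [|good]; last first.
  exists f; split=> // t t' ft ft' tt'; apply/eqP; apply: contraNT good => neq.
  by apply/existsP; exists t; apply/existsP; exists t'; apply/and4P.
case/existsP=> t /existsP[t' /and4P[neq ft ft' tt']].
pose f' x := if x == t then f t + f t' else if x == t' then 0 else f x.
have f't : f' t = f t + f t' by rewrite /f' eqxx.
apply: (IH f').
- move=> v; have [s [fs sv]] := domf v.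
  have [st'|sNt'] := eqVneq s t'.
    exists t; rewrite f't addn_gt0 ft; split=> //.
    by apply: dist_le_trans tt' _; rewrite -st'.
  exists s; rewrite /f' (negPf sNt'); case: eqP => [<-|//].
  by rewrite addn_gt0 fs; split=> //; apply: dist_le_weaken sv (leq_addr _ _).
- apply: leq_trans costf; rewrite /broadcast_cost.
  rewrite (bigD1 t) // (bigD1 t') 1?eq_sym //= [X in _ <= X](bigD1 t) //.
  rewrite [X in _ <= _ + X](bigD1 t') 1?eq_sym //= f't.
  rewrite {1}/f' eq_sym (negPf neq) eqxx add0n -addnA !leq_add2l.
  by apply/eq_leq/eq_bigr => i /andP[/negPf it /negPf it']; rewrite /f' it it'.
- apply: leq_trans supp_f; apply: proper_card; apply/properP; split.
    apply/subsetP=> x; rewrite !inE /f'; case: eqP => [->//|_].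
    by case: eqP.
  by exists t'; rewrite !inE // /f' eqxx eq_sym (negPf neq).
Qed.

End Walks.

(** * The greedy search *)

Section Search.
Variables (n : nat) (D : rel 'I_n.+1) (h : 'I_n.+1 -> nat) (k : nat).
Implicit Types (F f : 'I_n.+1 -> nat) (v t cur : 'I_n.+1).

(* The first [i] vertices are scanned for an undominated vertex of least
   potential; the second component is [n.+2] while none has been found. *)
Fixpoint scan F (i : nat) : 'I_n.+1 * nat :=
  if i is j.+1 then
    let v := inord j in
    if ~~ dominated D F v && (h v < (scan F j).2) then (v, h v) else scan F j
  else (ord0, n.+2).

Definition bump_at F cur : 'I_n.+1 -> nat := fun v => F v + (v == cur).

(* The bits of [c < 2 ^ k] are read off by doubling. *)
Fixpoint run (r c : nat) F cur : 'I_n.+1 -> nat :=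
  if r is r'.+1 then
    if 2 ^ k <= c + c then
      let s := (scan F n.+1).1 in run r' (c + c - 2 ^ k) (bump_at F s) s
    else run r' (c + c) (bump_at F cur) cur
  else F.

Lemma runS r c F cur :
  run r.+1 c F cur =
    if 2 ^ k <= c + c then
      let s := (scan F n.+1).1 in run r (c + c - 2 ^ k) (bump_at F s) s
    else run r (c + c) (bump_at F cur) cur.
Proof. by []. Qed.

Lemma le_bump_at F cur v : F v <= bump_at F cur v.
Proof. exact: leq_addr. Qed.

Lemma sum_bump_at F cur : \sum_v bump_at F cur v = (\sum_v F v).+1.
Proof.
rewrite big_split -[RHS]addn1 /=; congr (_ + _).
by rewrite (bigD1 cur) //= eqxx big1 // => i /negPf->.
Qed.

Lemma le_run r c F cur v : F v <= run r c F cur v.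
Proof.
elim: r c F cur => //= r IH c F cur.
by case: ifP => _; apply: leq_trans (IH _ _ _); apply: le_bump_at.
Qed.

Hypothesis hD : forall u v, D u v -> h u < h v.
Hypothesis h_max : forall v, h v <= n.+1.

(** By [h_max] the sentinel [n.+2] exceeds every potential, so the first undominated vertex met is
    always recorded. *)
Lemma scanP F :
  if n.+1 < (scan F n.+1).2 then all_dominated D F : Prop
  else let s := (scan F n.+1).1 in
    ~~ dominated D F s /\ forall v, ~~ dominated D F v -> h s <= h v.
Proof.
suff inv i : if n.+1 < (scan F i).2 then
    (scan F i).2 = n.+2 /\ forall v, v < i -> dominated D F v
  else [/\ (scan F i).2 = h (scan F i).1, ~~ dominated D F (scan F i).1
         & forall v, v < i -> ~~ dominated D F v -> h (scan F i).1 <= h v].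
  have := inv n.+1; case: ifP => _.
    by case=> _ dF; apply/forallP=> v; apply: dF.
  by case=> _ ud min; split=> // v; apply: min.
elim: i => [|i IH]; first by rewrite ltnSn.
have last_v (P : 'I_n.+1 -> Prop) : (forall v, v < i -> P v) -> P (inord i) ->
    forall v, v < i.+1 -> P v.
  move=> old new v; rewrite ltnS leq_eqVlt => /predU1P[vi|]; last exact: old.
  by rewrite -(inord_val v) vi.
rewrite [scan F i.+1]/=; case keep: (_ && _) => /=.
  have /andP[ud lth] := keep.
  rewrite ltnNge h_max; split=> //; apply: last_v => // v vi udv.
  move: IH lth; case: ifP => _ [e IH]; first by rewrite IH in udv.
  by move=> min; rewrite e => /ltnW/leq_trans; apply; apply: min.
move: IH keep; case: ifP => [_ [-> dF]|_ [-> ud min]].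
  rewrite ltnS (leq_trans (h_max _)) // andbT => /negbFE dv.
  by split=> //; apply: last_v.
move=> keep; split=> //; apply: last_v => // udv.
by move: keep; rewrite udv /= ltnNge => /negbFE.
Qed.

Lemma scan_all_dominated F : (n.+1 < (scan F n.+1).2) = all_dominated D F.
Proof.
have := scanP F; case: ifP => [_ ->//|_ [ud _]].
by apply/esym/negbTE/forallPn; exists (scan F n.+1).1.
Qed.

(* An undominated vertex [v] of least potential is covered in [f] by some [t];
   if [t != v] then [t] has smaller potential, hence is already dominated, by a
   vertex that is not [t], against irredundancy. *)
Lemma scan_forced f F :
  dominating_broadcast D f -> irredundant D f ->
  (forall v, F v <= f v) -> (forall v, 0 < F v -> F v = f v) ->
  ~~ all_dominated D F -> F (scan F n.+1).1 < f (scan F n.+1).1.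
Proof.
move=> domf irr leF eqF; have := scanP F; case: ifP => [_ ->//|_ [ud min] _].
set s := (scan F n.+1).1 in ud min *; have [t [ft ts]] := domf s.
(* Otherwise [F t = f t], and [t] would already dominate [s] in [F]. *)
have Ft0 : F t = 0.
  case: (posnP (F t)) => // Ft; case/negP: ud; apply/existsP; exists t.
  by rewrite Ft eqF.
suff -> : s = t by rewrite Ft0.
have [l [_ _ lts]] := dist_le_walk ts.
have /predU1P[->//|hts] := potential_walk hD lts.
have /existsP[t' /andP[Ft' t't]] : dominated D F t.
  by apply: contraLR hts => /min; rewrite -leqNgt.
have eqt' := eqF t' Ft'.
have tt' : t' = t by apply: irr; rewrite -?eqt'.
by rewrite tt' Ft0 in Ft'.
Qed.

(** The state [F] stays below [f] and has full power wherever it broadcasts, except possibly at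
    [cur]. A zero bit tops up [cur]; once [cur] is complete, a one bit moves to the vertex given by
    [scan_forced]. The [r] unread bits form [e], shifted left by the [k - r] positions already
    read. *)
Lemma run_complete f :
  dominating_broadcast D f -> irredundant D f -> broadcast_cost f <= k ->
  forall r F cur, r <= k -> (forall v, F v <= f v) ->
    (forall v, v != cur -> 0 < F v -> F v = f v) -> \sum_v F v = k - r ->
  exists2 e, e < 2 ^ r & all_dominated D (run r (e * 2 ^ (k - r)) F cur).
Proof.
move=> domf irr costf; elim=> [|r IH] F cur rk leF eqF sumF.
  (* All [k] units are spent, while [F <= f] pointwise and [f] costs at most [k]; hence [F] and [f]
     coincide. *)
  exists 0 => //=; apply/all_dominatedP; rewrite subn0 in sumF.
  have eqFf v : F v = f v.
    have : \sum_(i | true) F i == \sum_i f i.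
      rewrite eqn_leq leq_sum => [|i _]; last exact: leF.
      by rewrite sumF.
    rewrite (leqif_sum (C := fun i => F i == f i)) => [|i _]; last by split.
    by move/forall_inP/(_ v isT)/eqP.
  by move=> v; have [t] := domf v; exists t; rewrite eqFf.
(* Further units cannot spoil domination, so once [F] dominates any remaining bits will do. *)
have [dF|udF] := boolP (all_dominated D F).
  by exists 0; rewrite ?expn_gt0 //; apply: all_dominated_le dF; apply: le_run.
have kr : k - r = (k - r.+1).+1 by lia.
have e2k e : e < 2 ^ r -> e * 2 ^ (k - r) < 2 ^ k.
  by move=> er; rewrite -(subnKC (ltnW rk)) expnD addKn ltn_pmul2r ?expn_gt0.
have [Fcur|Fcur] := ltnP (F cur) (f cur).
  have [||||e er de] := IH (bump_at F cur) cur; first exact: ltnW.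
  - by move=> v; rewrite /bump_at; case: eqP => [->|_]; rewrite ?addn1 ?addn0.
  - by move=> v vc; rewrite /bump_at (negPf vc) addn0; apply: eqF.
  - by rewrite sum_bump_at sumF kr.
  have eq_run : run r.+1 (e * 2 ^ (k - r.+1)) F cur =
      run r (e * 2 ^ (k - r)) (bump_at F cur) cur.
    have := e2k e er; rewrite runS kr addnn -mul2n mulnCA -expnS -kr.
    by rewrite ltnNge => /negbTE->.
  by rewrite -eq_run in de; exists e => //; rewrite expnS; lia.
have eqF' v : 0 < F v -> F v = f v.
  have [->|] := eqVneq v cur; last exact: eqF.
  by move=> _; apply/eqP; rewrite eqn_leq leF.
have := scan_forced domf irr leF eqF' udF; set s := (scan F n.+1).1 => /= Fs.
have [||||e er de] := IH (bump_at F s) s; first exact: ltnW.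
- by move=> v; rewrite /bump_at; case: eqP => [->|_]; rewrite ?addn1 ?addn0.
- by move=> v vc; rewrite /bump_at (negPf vc) addn0; apply: eqF'.
- by rewrite sum_bump_at sumF kr.
(* The summand [2 ^ r] is a leading one bit: doubling carries it to [2 ^ k], which [run]
   subtracts. *)
have eq_run : run r.+1 ((2 ^ r + e) * 2 ^ (k - r.+1)) F cur =
    run r (e * 2 ^ (k - r)) (bump_at F s) s.
  rewrite runS addnn -mul2n mulnCA -expnS -kr mulnDl -expnD.
  by rewrite (subnKC (ltnW rk)) leq_addr addKn.
by rewrite -eq_run in de; exists (2 ^ r + e) => //; rewrite expnS; lia.
Qed.

Lemma sum_run r c F cur : \sum_v run r c F cur v = \sum_v F v + r.
Proof.
elim: r c F cur => [|r IH] c F cur /=; first by rewrite addn0.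
by case: ifP => _; rewrite IH sum_bump_at addSnnS.
Qed.

(** Soundness holds because every word spends exactly [k] units; completeness is [run_complete]
    started from the zero broadcast with all bits unread. *)
Lemma run_correct :
  (exists2 c, c < 2 ^ k & all_dominated D (run k c (fun=> 0) ord0)) <->
  broadcast_domination D k.
Proof.
split=> [[c _ /all_dominatedP dc]|].
  by exists (run k c (fun=> 0) ord0); rewrite /broadcast_cost sum_run big1.
case/irredundant_broadcast=> f [domf costf irr].
have := run_complete domf irr costf (F := fun=> 0) (cur := ord0) (leqnn k).
case=> [//|//||e ek de].
  by rewrite big1 // subnn.
by exists e => //; rewrite subnn muln1 in de.
Qed.

End Search.

(** * Programs *)

Lemma nth_allpairs (S T : Type) (f : S -> T -> nat) x0 y0 s t i j :
  i < size s -> j < size t ->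
  nth 0 [seq f x y | x <- s, y <- t] (i * size t + j) =
    f (nth x0 s i) (nth y0 t j).
Proof.
move=> + lt_j; elim: s i => [//|a s IH] [|i] /= lt_i; rewrite nth_cat size_map.
  by rewrite lt_j (nth_map y0).
by rewrite mulSn -addnA ltnNge leq_addr /= addKn IH.
Qed.

(** * Weakest preconditions with running times *)

Section Triples.
Variable x : seq nat.
Implicit Types (p q : cmd) (m : memory) (a b : expr).
Implicit Types Q : nat -> memory -> Prop.

(** Total correctness: the run must halt, and the postcondition also sees its exact number of
    steps. *)
Definition wp p Q m : Prop := exists t m', exec x p m t m' /\ Q t m'.

Lemma wp_weaken p Q Q' m :
  wp p Q m -> (forall t m', Q t m' -> Q' t m') -> wp p Q' m.
Proof. by case=> t [m' [ex q]] QQ'; exists t, m'; split=> //; apply: QQ'. Qed.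

Lemma wp_skip Q m : Q 1 m -> wp Skip Q m.
Proof. by exists 1, m; split=> //; apply: exec_skip. Qed.

Lemma wp_store a b Q m :
  Q (eval_time a + eval_time b).+1 (update m (eval x m a) (eval x m b)) ->
  wp (Store a b) Q m.
Proof. by move=> q; do 2!eexists; split; first exact: exec_store. Qed.

Lemma wp_seq p q Q m :
  wp p (fun t m1 => wp q (fun t1 m2 => Q (t + t1) m2) m1) m -> wp (Seq p q) Q m.
Proof.
case=> t [m1 [ex [t1 [m2 [ex1 post]]]]]; exists (t + t1), m2; split=> //.
exact: exec_seq ex ex1.
Qed.

Lemma wp_if a p q Q m :
  (0 < eval x m a -> wp p (fun t => Q (eval_time a + t).+1) m) ->
  (eval x m a = 0 -> wp q (fun t => Q (eval_time a + t).+1) m) ->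
  wp (If a p q) Q m.
Proof.
case: (posnP (eval x m a)) => [a0 _ /(_ a0)|a1 /(_ isT) + _].
  case=> t [m' [ex post]]; exists (eval_time a + t).+1, m'; split=> //.
  exact: exec_if_false.
case=> t [m' [ex post]]; exists (eval_time a + t).+1, m'; split=> //.
exact: exec_if_true.
Qed.

Definition For (i : nat) a p : cmd :=
  Seq (Store (Const i) (Const 0))
      (While (Sub a (Mem (Const i)))
             (Seq p (Store (Const i) (Add (Mem (Const i)) (Const 1))))).

(** The inner 20 covers the guard and the increment of one round, the outer one the initialization
    and the final test. *)
Definition for_time (N T : nat) : nat := N * (T + 20) + 20.

(** The guard re-evaluates [a] in every round, so [Inv] has to fix its value and its cost is capped.
    The body must leave the counter cell as it found it. *)
Lemma wp_for i a p (N T : nat) (Inv : nat -> memory -> Prop) Q m :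
  eval_time a <= 5 ->
  Inv 0 (update m i 0) ->
  (forall j m, Inv j m -> eval x m a = N) ->
  (forall j m, j < N -> Inv j m -> m i = j ->
     wp p (fun t m' =>
       [/\ t <= T, m' i = j & Inv j.+1 (update m' i j.+1)]) m) ->
  (forall t m, t <= for_time N T -> Inv N m -> Q t m) ->
  wp (For i a p) Q m.
Proof.
move=> ta Inv0 evN body post; apply/wp_seq/wp_store => /=.
suff loop r : forall j m, r + j = N -> Inv j m -> m i = j ->
    wp (While (Sub a (Mem (Const i)))
           (Seq p (Store (Const i) (Add (Mem (Const i)) (Const 1)))))
      (fun t m' => t <= r * (T + 20) + 10 /\ Inv N m') m.
  apply: wp_weaken (loop N 0 _ (addn0 _) Inv0 _) _.
    by rewrite /update eqxx.
  by move=> t m' [tN]; apply: post; rewrite /for_time; lia.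
elim: r => [|r IH] j m0 rj Invj mij.
  eexists _, m0; split; first apply: exec_while_false.
    by rewrite /= mij (evN j) // -rj add0n subnn.
  by rewrite -rj /=; split=> //; lia.
have [|t [m1 [ex1 [t1 m1i Inv1]]]] := body j m0 _ Invj mij; first by lia.
have [||t2 [m2 [ex2 [t2r post2]]]] := IH j.+1 (update m1 i j.+1) _ Inv1.
- by lia.
- by rewrite /update eqxx.
eexists _, m2; split; first apply: exec_while_true ex2.
- by rewrite /= mij (evN j) // subn_gt0; lia.
- apply: exec_seq ex1 _.
  suff -> : j.+1 = eval x m1 (Add (Mem (Const i)) (Const 1)).
    exact: (exec_store _ (Const i)).
  by rewrite /= m1i addn1.
- by split=> //=; lia.
Qed.

End Triples.

(** * The search program *)

Definition In0 := Input (Const 0).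
Definition In1 := Input (Const 1).
Definition Var i := Mem (Const i).

(* Work memory: scalars below 12, then three interleaved arrays indexed by the
   vertices: [0] the potential, [1] the broadcast, [2] the remaining power. *)
Definition addr (b v : nat) : nat := 12 + b + (v + (v + v)).
Definition Addr (b i : nat) : expr :=
  Add (Const (12 + b)) (Add (Var i) (Add (Var i) (Var i))).
Definition Cell b i := Mem (Addr b i).

(* Cell 5 counts rounds, 6 and 7 are the ends of the arc under consideration and
   8 is its position in the input. *)
Definition relax_cmd (b : nat) (G : expr -> expr) : cmd :=
  For 5 In0 (Seq (Store (Const 8) (Const 2))
    (For 6 In0 (For 7 In0
      (Seq (If (Input (Var 8))
               (Store (Addr b 7)
                      (Add (Cell b 7) (Sub (G (Cell b 6)) (Cell b 7))))
               Skip)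
           (Store (Const 8) (Add (Var 8) (Const 1))))))).

(* Cells 10 and 11 receive the result of [scan]. *)
Definition scan_cmd : cmd :=
  Seq (For 6 In0 (Store (Addr 2 6)
         (Add (Cell 1 6) (Sub (Const 1) (Sub (Const 1) (Cell 1 6))))))
 (Seq (relax_cmd 2 (fun a => Sub a (Const 1)))
 (Seq (Store (Const 10) (Const 0))
 (Seq (Store (Const 11) (Add In0 (Const 1)))
      (For 6 In0
        (If (Cell 2 6) Skip
            (If (Sub (Var 11) (Cell 0 6))
                (Seq (Store (Const 10) (Var 6)) (Store (Const 11) (Cell 0 6)))
                Skip)))))).

(* Cell 3 holds the remaining bits, cell 9 the current vertex. *)
Definition trial_cmd : cmd :=
  Seq (For 6 In0 (Store (Addr 1 6) (Const 0)))
 (Seq (Store (Const 3) (Var 2))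
 (Seq (Store (Const 9) (Const 0))
 (Seq scan_cmd
 (Seq (For 4 In1
        (Seq (Store (Const 3) (Add (Var 3) (Var 3)))
        (Seq (If (Sub (Add (Var 3) (Const 1)) (Var 1))
                 (Seq (Store (Const 3) (Sub (Var 3) (Var 1)))
                      (Store (Const 9) (Var 10)))
                 Skip)
        (Seq (Store (Addr 1 9) (Add (Cell 1 9) (Const 1)))
             scan_cmd))))
      (If (Sub (Var 11) In0) (Store (Const 0) (Const 1)) Skip))))).

(* Cell 1 holds [2 ^ k]. *)
Definition broadcast_cmd : cmd :=
  Seq (relax_cmd 0 (fun a => Add a (Const 1)))
 (Seq (Store (Const 1) (Const 1))
 (Seq (For 5 In1 (Store (Const 1) (Add (Var 1) (Var 1))))
      (For 2 (Var 1) trial_cmd))).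

Lemma update_eq (m : memory) a c : update m a c a = c.
Proof. by rewrite /update eqxx. Qed.

Lemma update_neq (m : memory) a c b : b <> a -> update m a c b = m b.
Proof. by rewrite /update; case: eqP. Qed.

Ltac upd :=
  repeat first [rewrite update_eq
               | rewrite update_neq; [|solve [rewrite /addr; lia]]].

(** * Correctness of the program *)

Section Correctness.
Variables (n : nat) (D : rel 'I_n.+1) (k : nat).
Let x := encode D k.
Implicit Types (m : memory) (v u w : 'I_n.+1).

Lemma encode_arc u w : nth 0 x (u * n.+1 + w).+2 = D u w.
Proof.
pose e := enum 'I_n.+1.
have := @nth_allpairs _ _ (fun i j => D i j) u w e e u w.
by rewrite size_enum_ord !nth_ord_enum; apply.
Qed.

Definition arr b m : 'I_n.+1 -> nat := fun v => m (addr b v).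

Definition keeps (P : pred nat) m m' := forall a, P a -> m' a = m a.

Lemma keeps_trans P m1 m2 m3 : keeps P m1 m2 -> keeps P m2 m3 -> keeps P m1 m3.
Proof. by move=> k1 k2 a Pa; rewrite k2 // k1. Qed.

Lemma keeps_update P m m' a c :
  keeps P m m' -> ~~ P a -> keeps P m (update m' a c).
Proof.
move=> km nPa b Pb; rewrite /update; case: eqP => [e|_]; last exact: km.
by rewrite -e Pb in nPa.
Qed.

Lemma arr_update_out b m a c v : a < 12 -> arr b (update m a c) v = arr b m v.
Proof. by move=> a12; apply: update_neq; rewrite /addr; lia. Qed.

Lemma arr_update b m u c v :
  arr b (update m (addr b u) c) v = if v == u then c else arr b m v.
Proof.
rewrite /arr; case: eqP => [->|vu]; first exact: update_eq.
by apply: update_neq => e; apply/vu/val_inj; move: e; rewrite /addr /=; lia.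
Qed.

(** For [b < 3], [addr b v] is congruent to [b] modulo 3, so the residue of an address tells its
    array. *)
Definition outside_array b a := (a < 12) || (a %% 3 != b).

Definition kept_by_relax b a := (a \notin [:: 5; 6; 7; 8]) && outside_array b a.

Ltac kept := rewrite /kept_by_relax /outside_array ?inE; lia.

Definition relax_time N := for_time N (3 + for_time N (for_time N 60)).

(** The loop invariants instantiate [relaxing]: at counters [u] and [w] the arcs done in the round
    are the lexicographic predecessors of [(u, w)], and cell 8 points at the matrix entry of this
    pair, behind the two header cells. *)
Lemma relax_cmd_spec b G g m :
  b < 3 -> {homo g : i j / i <= j} ->
  (forall m a, eval x m (G a) = g (eval x m a)) ->
  (forall a, eval_time (G a) <= eval_time a + 2) ->
  wp x (relax_cmd b G) (fun t m' =>
    [/\ t <= relax_time n.+1, relaxed D g (arr b m) (arr b m')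
      & keeps (kept_by_relax b) m m']) m.
Proof.
move=> b3 g_homo evG timeG.
pose R := relaxing D g (arr b m).
apply: (@wp_for _ _ _ _ n.+1 (3 + for_time n.+1 (for_time n.+1 60)) (fun i m' =>
  keeps (kept_by_relax b) m m' /\ R i (fun _ _ => false) (arr b m'))) => //.
- split; first by apply: keeps_update.
  apply: relaxing_eq _ (relaxing0 _ _ _) => v; exact: arr_update_out.
- move=> i {}m' i_n [km Rm] mi; apply/wp_seq/wp_store => /=.
  apply: (@wp_for _ _ _ _ n.+1 (for_time n.+1 60) (fun (u : nat) m' =>
    [/\ keeps (kept_by_relax b) m m', R i (fun u' _ => u' < u) (arr b m'),
        m' 5 = i & m' 8 = (u * n.+1).+2])) => //.
  + split; [|exact: Rm|by upd|by upd].
    by do 2!apply: keeps_update => //.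
  + move=> u m1 u_n [km1 Rm1 m15 m18] m16.
    apply: (@wp_for _ _ _ _ n.+1 60 (fun (w : nat) m' =>
      [/\ keeps (kept_by_relax b) m m',
          R i (fun u' w' => (u' < u) || (u' == u :> nat) && (w' < w))
            (arr b m'),
          m' 5 = i, m' 6 = u & m' 8 = (u * n.+1 + w).+2])) => //.
    * split; [exact: keeps_update| |by upd|by upd|by upd; rewrite m18 addn0].
      apply: relaxing_eq _ (relaxing_sub _ Rm1) => // u' w'.
      by rewrite andbF orbF.
    * move=> w m2 w_n [km2 Rm2 m25 m26 m28] m27.
      pose u1 := Ordinal u_n; pose w1 := Ordinal w_n.
      have sub u' w' : (u' < u) || (u' == u :> nat) && (w' < w.+1) ->
          ((u' < u) || (u' == u :> nat) && (w' < w)) \/ u' = u1 /\ w' = w1.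
        case/orP=> [->|/andP[/eqP uu]]; first by left.
        rewrite ltnS leq_eqVlt => /predU1P[ww|->]; last first.
          by left; rewrite uu eqxx orbT.
        by right; split; apply: val_inj.
      have D_uw : nth 0 x (m2 8) = D u1 w1 by rewrite m28 (encode_arc u1 w1).
      apply/wp_seq/wp_if => /=; rewrite D_uw => Duw.
        apply: wp_store; apply: wp_store => /=.
        have := timeG (Cell b 6) => /= tG.
        split; first by lia.
          by upd.
        split; [| |by upd|by upd|by upd; rewrite m28; lia].
        - by do 3!(apply: keeps_update; last by rewrite ?m27; kept).
        - apply: (relaxing_step g_homo sub Rm2) => [|v].
            by case: (D _ _) Duw.
          rewrite arr_update_out // arr_update_out // m27 (arr_update _ _ w1).
          by case: eqP => // _; rewrite evG /= m26.
      apply: wp_skip; apply: wp_store => /=; split=> //.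
      split; [| |by upd|by upd|by upd; rewrite m28; lia].
      - by do 2!(apply: keeps_update; last by kept).
      - apply: relaxing_eq _ (relaxing_skip sub _ Rm2) => [v|].
          by rewrite !arr_update_out.
        by case: (D _ _) Duw.
    * move=> t m2 tT [km2 Rm2 m25 m26 m28]; split=> //.
      split; [exact: keeps_update| |by upd|by upd; rewrite m28; lia].
      apply: relaxing_eq _ (relaxing_sub _ Rm2) => // u' w'.
      by rewrite ltnS leq_eqVlt orbC ltn_ord andbT.
  + move=> t m1 tT [km1 Rm1 m15 m18]; split; rewrite ?addSn ?ltnS //.
    split; first by apply: keeps_update.
    apply: relaxing_eq _ (relaxing_next _ Rm1) => [v|u' w' /=].
      by rewrite !arr_update_out.
    exact: ltn_ord.
- move=> t m' tT [km Rm]; split=> //; apply: relaxing_relaxed Rm.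
  by rewrite card_ord.
Qed.

Lemma keeps_arr P b m m' :
  keeps P m m' -> (forall v, P (addr b v)) -> arr b m' =1 arr b m.
Proof. by move=> km Pb v; apply: km. Qed.

Variable h : 'I_n.+1 -> nat.

Definition kept_by_scan a :=
  (a \notin [:: 5; 6; 7; 8; 10; 11]) && outside_array 2 a.

Definition scan_time N := for_time N 60 + (relax_time N + (9 + for_time N 60)).

Ltac kept_scan := rewrite /kept_by_scan /outside_array /addr ?inE; lia.

Lemma scan_cmd_spec F m :
  arr 0 m =1 h -> arr 1 m =1 F ->
  wp x scan_cmd (fun t m' =>
    [/\ t <= scan_time n.+1, m' 10 = (scan D h F n.+1).1,
        m' 11 = (scan D h F n.+1).2 & keeps kept_by_scan m m']) m.
Proof.
move=> mh mF; apply: wp_seq.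
have keep_h m' : keeps kept_by_scan m m' -> arr 0 m' =1 h.
  by move=> km v; rewrite (keeps_arr km) => [//|v']; kept_scan.
have keep_F m' : keeps kept_by_scan m m' -> arr 1 m' =1 F.
  by move=> km v; rewrite (keeps_arr km) => [//|v']; kept_scan.
apply: (@wp_for _ _ _ _ n.+1 60 (fun i m' => keeps kept_by_scan m m' /\
  forall v, v < i -> arr 2 m' v = F v + (1 - (1 - F v)))) => //.
- by split=> //; apply: keeps_update.
- move=> i m1 i_n [km1 R1] m16; pose u := Ordinal i_n.
  apply: wp_store; rewrite /= m16; split=> //.
  split; first by do 2!(apply: keeps_update; last by kept_scan).
  move=> v vi; rewrite arr_update_out // (arr_update _ _ u).
  case: eqP => [->|vu]; first by rewrite -!(keep_F m1).
  apply: R1; move: vi; rewrite ltnS leq_eqVlt => /predU1P[e|//].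
  by case: vu; apply: val_inj.
move=> t1 m1 t1T [km1 R1]; apply: wp_seq.
apply: wp_weaken (relax_cmd_spec (g := predn) m1 _ _ _ _) _ => //.
- by move=> i j ij; lia.
- by move=> m2 a /=; rewrite subn1.
- by move=> a /=; lia.
move=> t2 m2 [t2T rel km2]; do 2!apply/wp_seq/wp_store => /=.
have dom v : (0 < arr 2 m2 v) = dominated D F v.
  apply: relaxed_dominated; apply: relaxed_eq rel => w; exact: R1.
have km : keeps kept_by_scan m m2.
  apply: keeps_trans km1 _ => a Pa; apply: km2; move: Pa.
  by rewrite /kept_by_relax; kept_scan.
apply: (@wp_for _ _ _ _ n.+1 60 (fun i m' =>
  [/\ keeps kept_by_scan m m', forall v, (0 < arr 2 m' v) = dominated D F v,
      m' 10 = (scan D h F i).1 & m' 11 = (scan D h F i).2])) => //.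
- split; [| |by upd|by upd; rewrite /= addn1].
    by do 3!(apply: keeps_update; last by kept_scan).
  by move=> v; rewrite !arr_update_out.
- move=> i m3 i_n [km3 dom3 m3b m3v] m36; pose u := Ordinal i_n.
  have iu : inord i = u by apply: val_inj; rewrite /= inordK.
  have m3h : m3 (12 + 0 + (i + (i + i))) = h u by rewrite -(keep_h m3).
  have := dom3 u; rewrite {1}/arr /addr /= => dom_u.
  apply: wp_if => /=; rewrite m36.
    rewrite dom_u => du; apply: wp_skip; split=> //.
    split; [by apply: keeps_update; last by kept_scan| | |].
    + by move=> v; rewrite arr_update_out.
    + by upd; rewrite iu du.
    + by upd; rewrite iu du.
  move=> ndu; have {ndu} du : dominated D F u = false by rewrite -dom_u ndu.
  apply: wp_if; rewrite /= m36 m3h m3v.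
    rewrite subn_gt0 => lth; apply/wp_seq/wp_store/wp_store => /=.
    split=> //; split; [| | |].
    + by do 3!(apply: keeps_update; last by kept_scan).
    + by move=> v; rewrite !arr_update_out.
    + by upd; rewrite iu du lth.
    + by upd; rewrite iu du lth /= m36.
  move/eqP; rewrite subn_eq0 leqNgt => /negbTE lth; apply: wp_skip; split=> //.
  split; [by apply: keeps_update; last by kept_scan| | |].
  + by move=> v; rewrite arr_update_out.
  + by upd; rewrite iu du lth.
  + by upd; rewrite iu du lth.
- by move=> t m3 tT [km3 _ m3b m3v]; split=> //; rewrite /scan_time; lia.
Qed.

Hypothesis h_max : forall v, h v <= n.+1.

Definition accepted c := all_dominated D (run D h k k c (fun=> 0) ord0).

(** The data shared by all trials: [2 ^ k], the word being tried, and the potentials. *)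
Definition kept_by_trial a := (a \in [:: 1; 2]) || (12 <= a) && (a %% 3 == 0).

Definition trial_time N k :=
  for_time N 60 + (scan_time N + for_time k (70 + scan_time N) + 40).

Ltac kept_trial := rewrite /kept_by_trial /addr ?inE; lia.

(** A scan precedes the first bit and follows every bit, so cells 10 and 11 always describe the
    present broadcast. The invariant says that continuing [run] on the unread bits decides
    acceptance of the original word. *)
Lemma trial_cmd_spec m :
  arr 0 m =1 h -> m 1 = 2 ^ k ->
  wp x trial_cmd (fun t m' =>
    [/\ t <= trial_time n.+1 k, (0 < m' 0) = (0 < m 0) || accepted (m 2)
      & keeps kept_by_trial m m']) m.
Proof.
(* [K] also protects cell 0, which is untouched until the final verdict. *)
move=> mh m1; pose K a := (a == 0) || kept_by_trial a.
have K_trial m' : keeps K m m' -> keeps kept_by_trial m m'.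
  by move=> km a Pa; apply: km; rewrite /K Pa orbT.
have keep_h m' : keeps K m m' -> arr 0 m' =1 h.
  by move=> km v; rewrite (keeps_arr km) => [//|v']; rewrite /K; kept_trial.
have keep_scan m1' m2' :
    keeps K m m1' -> keeps kept_by_scan m1' m2' -> keeps K m m2'.
  move=> km ks; apply: keeps_trans km _ => a Pa; apply: ks; move: Pa.
  by rewrite /K /kept_by_trial /kept_by_scan /outside_array !inE; lia.
apply: wp_seq; apply: (@wp_for _ _ _ _ n.+1 60 (fun i m' =>
  keeps K m m' /\ forall v, v < i -> arr 1 m' v = 0)) => //.
- by split=> //; apply: keeps_update.
- move=> i m2 i_n [km2 F2] m26; pose u := Ordinal i_n.
  apply: wp_store; rewrite /= m26; split=> //.
  split; first by do 2!(apply: keeps_update; last by rewrite /K; kept_trial).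
  move=> v vi; rewrite arr_update_out // (arr_update _ _ u).
  case: eqP => [//|vu]; apply: F2.
  move: vi; rewrite ltnS leq_eqVlt => /predU1P[e|//].
  by case: vu; apply: val_inj.
move=> t2 m2 t2T [km2 F2]; do 2!apply/wp_seq/wp_store => /=; apply: wp_seq.
set m3 := update _ 9 0.
have km3 : keeps K m m3 by do 2!apply: keeps_update => //.
have F3 : arr 1 m3 =1 fun=> 0 by move=> v; rewrite !arr_update_out // F2.
apply: wp_weaken (scan_cmd_spec (keep_h _ km3) F3) _ => t4 m4 [t4T m4b m4v ks4].
have km4 := keep_scan _ _ km3 ks4.
apply: wp_seq; apply: (@wp_for _ _ _ _ k (70 + scan_time n.+1) (fun j m' =>
  keeps K m m' /\ exists F (cur : 'I_n.+1),
    [/\ arr 1 m' =1 F, m' 9 = cur, m' 10 = (scan D h F n.+1).1,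
        m' 11 = (scan D h F n.+1).2
      & all_dominated D (run D h k (k - j) (m' 3) F cur) = accepted (m 2)]))
  => //.
- split; first by apply: keeps_update.
  exists (fun=> 0), ord0.
  split; [|by upd; rewrite ks4 // /m3; upd|by upd|by upd|].
    move=> v; rewrite arr_update_out // (keeps_arr ks4) // => v'.
    by rewrite /kept_by_scan /outside_array /addr !inE; lia.
  by upd; rewrite ks4 // /m3 subn0; upd; rewrite km2.
- move=> j m5 j_k [km5 [F [cur [F5 m5c m5b m5v run5]]]] m5j.
  apply/wp_seq/wp_store => /=.
  have m5_1 : m5 1 = 2 ^ k by rewrite km5.
  rewrite -subnSK // runS in run5.
  apply: wp_seq; apply: (@wp_weaken _ _ (fun t m' =>
    [/\ t <= 30, keeps K m m', m' 4 = j, arr 1 m' =1 F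
      & exists cur' : 'I_n.+1, m' 9 = cur' /\
          all_dominated D (run D h k (k - j.+1) (m' 3) (bump_at F cur') cur')
            = accepted (m 2)])).
    (* Guards only test for nonzero: [c.+1 - 2 ^ k] is positive exactly when [2 ^ k <= c]. *)
    apply: wp_if => /=; upd; rewrite m5_1 addn1.
      rewrite subn_gt0 ltnS => bit; apply/wp_seq/wp_store/wp_store => /=; upd.
      rewrite bit /= in run5; split=> //.
        by do 3!apply: keeps_update => //.
      by exists (scan D h F n.+1).1; upd; rewrite m5_1.
    move/eqP; rewrite subn_eq0 ltnNge => /negbTE bit; apply: wp_skip; upd.
    rewrite bit in run5; split=> //; first by apply: keeps_update.
    by exists cur; upd.
  move=> t6 m6 [t6T km6 m6j F6 [cur' [m6c run6]]].
  apply/wp_seq/wp_store => /=; rewrite m6c.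
  set m7 := update _ _ _.
  have km7 : keeps K m m7 by apply: keeps_update => //; rewrite /K; kept_trial.
  have F7 : arr 1 m7 =1 bump_at F cur'.
    move=> v; rewrite (arr_update _ _ cur') /bump_at.
    by case: eqP => [->|_]; rewrite -F6 ?addn0.
  apply: wp_weaken (scan_cmd_spec (keep_h _ km7) F7) _.
  move=> t8 m8 [t8T m8b m8v ks8]; have km8 := keep_scan _ _ km7 ks8.
  split; first by lia.
    by rewrite ks8 // /m7; upd.
  split; first by apply: keeps_update.
  exists (bump_at F cur'), cur'.
  split; [|by upd; rewrite ks8 // /m7; upd|by upd|by upd|].
    move=> v; rewrite arr_update_out // (keeps_arr ks8) // => v'.
    by rewrite /kept_by_scan /outside_array /addr !inE; lia.
  by upd; rewrite ks8 // /m7; upd.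
- move=> t5 m5 t5T [km5 [F [cur [F5 m5c m5b m5v]]]]; rewrite subnn /= => acc.
  have acc5 : (0 < m5 11 - n.+1) = accepted (m 2).
    by rewrite m5v subn_gt0 scan_all_dominated.
  apply: wp_if => /= [|/eqP].
    rewrite acc5 => acc_c; apply: wp_store; split=> /=.
    + by rewrite /trial_time; lia.
    + by upd; rewrite acc_c orbT.
    + by apply: keeps_update; [apply: K_trial | kept_trial].
  rewrite eqn0Ngt acc5 => /negbTE rej; apply: wp_skip; split.
  + by rewrite /trial_time; lia.
  + by rewrite km5 // rej orbF.
  + exact: K_trial.
Qed.

End Correctness.

(** * The whole program and its running time *)

Definition broadcast_time N k :=
  relax_time N + (for_time k 10 + (for_time (2 ^ k) (trial_time N k) + 10)).

Lemma broadcast_cmd_spec n (D : rel 'I_n.+1) k :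
  acyclic D ->
  wp (encode D k) broadcast_cmd (fun t m =>
    t <= broadcast_time n.+1 k /\ (0 < m 0 <-> broadcast_domination D k))
    (fun=> 0).
Proof.
move=> acD; apply: wp_seq.
apply: wp_weaken (relax_cmd_spec (g := succn) _ _ _ _ _) _ => //.
- by move=> m a /=; rewrite addn1.
- by move=> a /=; lia.
move=> t1 m1 [t1T rel km1]; have [hD h_max] := relaxed_potential acD rel.
rewrite card_ord in h_max; set h := arr 0 m1 in rel hD h_max.
apply/wp_seq/wp_store/wp_seq => /=.
apply: (@wp_for _ _ _ _ k 10 (fun j m =>
  [/\ arr (n := n) 0 m =1 h, m 1 = 2 ^ j & m 0 = 0])) => //.
- split; [by move=> v; rewrite !arr_update_out|by upd|by upd; rewrite km1].
- move=> j m j_k [mh mQ m0] mj; apply: wp_store => /=; split=> //.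
  split; [by move=> v; rewrite !arr_update_out| |by upd].
  by upd; rewrite mQ addnn -mul2n -expnS.
move=> t2 m2 t2T [m2h m2Q m20].
(* Cell 0 accumulates the disjunction of the verdicts on the words below [c]. *)
apply: (@wp_for _ _ _ _ (2 ^ k) (trial_time n.+1 k) (fun c m =>
  [/\ arr (n := n) 0 m =1 h, m 1 = 2 ^ k
    & 0 < m 0 <-> exists2 c', c' < c & accepted D k h c'])) => //.
- split; [by move=> v; rewrite !arr_update_out|by upd|].
  by upd; rewrite m20; split=> [//|[]].
- by move=> c m [].
- move=> c m c_k [mh mQ ans] mc.
  apply: wp_weaken (trial_cmd_spec D h_max mh mQ) _ => t m' [tT m'0 km].
  split=> //; first by rewrite km.
  split.
  + move=> v; rewrite arr_update_out // -mh; apply: km.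
    by rewrite /kept_by_trial /addr; lia.
  + by upd; rewrite km.
  + upd; rewrite m'0 mc; split.
      case/orP=> [/ans[c' c'c acc]|acc]; last by exists c.
      by exists c' => //; apply: ltnW.
    case=> c'; rewrite ltnS leq_eqVlt => /predU1P[->->|c'c acc].
      by rewrite orbT.
    by have -> : 0 < m 0 by apply/ans; exists c'.
move=> t3 m3 t3T [_ _ ans]; split; first by rewrite /broadcast_time; lia.
exact: iff_trans ans (run_correct k hD h_max).
Qed.

(** The additive constants are absorbed into the coefficient, so nesting loops multiplies the main
    term by [N] and adds only 40 to [a]. *)
Lemma for_time_le N T a B :
  0 < N -> 0 < B -> T <= a * B -> for_time N T <= (a + 40) * (N * B).
Proof.
move=> N0 B0 TB; have NB : 0 < N * B by rewrite muln_gt0 N0.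
have : N * (T + 20) <= N * ((a + 20) * B) by rewrite leq_mul2l; nia.
by rewrite /for_time mulnCA; nia.
Qed.

(** The cube comes from [N] rounds over [N ^ 2] possible arcs. One factor [2 ^ k] counts the words,
    the other absorbs the [k + 1] scans of a trial, and [2 ^ 12] covers the coefficients. *)
Lemma broadcast_time_le N k :
  0 < N -> broadcast_time N k <= 2 ^ (2 * k + 12) * N ^ 3.
Proof.
move=> N0; set B := N ^ 3.
have eB : N * (N * (N * 1)) = B by rewrite muln1.
have N1 : 0 < N * 1 by rewrite muln1.
have N2 : 0 < N * (N * 1) by rewrite muln_gt0 N0.
have N2B : N * (N * 1) <= B by rewrite -eB leq_pmull.
have N1B : N * 1 <= B by apply: leq_trans N2B; apply: leq_pmull.
have B0 : 0 < B by rewrite expn_gt0 N0.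
have for60N : for_time N 60 <= 100 * (N * 1) by apply: (for_time_le (a := 60)).
have for60 : for_time N 60 <= 100 * B.
  by apply: leq_trans for60N _; rewrite leq_mul2l.
have relaxT : relax_time N <= 183 * B.
  rewrite /relax_time -eB; apply: (for_time_le (a := 143)) => //.
  by have := for_time_le N0 N1 for60N; lia.
have scanT : scan_time N <= 400 * B by rewrite /scan_time; lia.
have two_k := ltn_expl k (isT : 1 < 2).
have k_scan : for_time k (70 + scan_time N) <= 490 * (k * B) + 20.
  by rewrite /for_time; nia.
have trialT : trial_time N k <= 1000 * (2 ^ k * B).
  by rewrite /trial_time; nia.
have Q0 : 0 < 2 ^ k by rewrite expn_gt0.
have QB : 0 < 2 ^ k * B by rewrite muln_gt0 Q0.
have := for_time_le Q0 QB trialT.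
rewrite [2 ^ k * _]mulnA -expnD addnn -mul2n => all_trials.
have kk : for_time k 10 <= 50 * 2 ^ k by rewrite /for_time; lia.
have QQ : 2 ^ k <= 2 ^ (2 * k) by rewrite leq_exp2l; lia.
by rewrite /broadcast_time expnD; nia.
Qed.

Theorem theorem3 :
  exists (p : cmd) (g : nat -> nat) (c : nat),
    bigO g (fun k => k * trunc_log 2 k) /\
    forall (n : nat) (D : rel 'I_n) (k : nat),
      0 < n -> weakly_connected D -> acyclic D ->
      decides_within p (encode D k) (broadcast_domination D k)
        (2 ^ g k * n ^ c).
Proof.
exists broadcast_cmd, (fun k => 2 * k + 12), 3; split.
  (* From [k = 2] on the logarithm is at least 1, so [2 * k + 12 <= 14 * k] is enough. *)
  exists 14, 2 => k k2; have : 0 < trunc_log 2 k by rewrite trunc_log_gt0.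
  nia.
case=> // n D k _ _ acD.
have [t [m [run [tT ans]]]] := broadcast_cmd_spec k acD.
by exists t, m; split=> //; apply: leq_trans tT (broadcast_time_le _ _).
Qed.
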